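(* Let $k\ge 2$ be an integer and let $a,b,c,d$ be non-negative integers with $a+b=c+d=S\ge 2$ and $\{a,b\}\ne\{c,d\}$. Then \[ \bigl|a^k+b^k-c^k-d^k\bigr|\ \ge\ k(k-1)\,\lfloor S/2\rfloor^{k-2}\ \ge\ C_k\,S^{k-2},\qquad C_k=k(k-1)\,3^{2-k}. \] *)

(* Defs.v *)
From mathcomp Require Export all_boot all_order all_algebra finmap.
Local Open Scope ring_scope.

Definition C_ (k : nat) : rat := k%:R * (k%:R - 1) * 3%:R ^ (2%:Z - k%:Z).

(* Main.v *)
Require Import Defs.
From mathcomp Require Import all_boot all_order all_algebra finmap.
From mathcomp Require Import zify ring lra.
Import Order.TTheory GRing.Theory Num.Theory.
Local Open Scope ring_scope.

(** Write the pairs as [m + u, m - u] and [m + v, m - v].  The binomial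
    expansion of [(m + u) ^+ k + (m - u) ^+ k] contains only even powers of [u],
    with nonnegative coefficients, so its increment from [v] to [u] is at least
    that of its quadratic term, [k * (k - 1) * m ^+ (k - 2) * u ^+ 2].  Here
    [u ^+ 2 - v ^+ 2] is the difference of the products of the two pairs, a
    nonzero integer as soon as the pairs differ. *)

Lemma exprD_add_exprB (R : comPzRingType) (m u : R) k :
  (m + u) ^+ k + (m - u) ^+ k =
  \sum_(i < k.+1 | ~~ odd i) (m ^+ (k - i) * u ^+ i) *+ 2 *+ 'C(k, i).
Proof.
rewrite exprDn exprBn -big_split [RHS]big_mkcond; apply: eq_bigr => i _ /=.
rewrite -mulrA -signr_odd -mulrnDl.
by case: odd; rewrite ?mulN1r ?mul1r ?subrr ?mul0rn.
Qed.

Lemma exprD_add_exprB_gap (R : realDomainType) (m u v : R) k :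
  0 <= m -> v ^+ 2 <= u ^+ 2 ->
  k.+2%:R * k.+1%:R * m ^+ k * (u ^+ 2 - v ^+ 2)
    <= ((m + u) ^+ k.+2 + (m - u) ^+ k.+2)
       - ((m + v) ^+ k.+2 + (m - v) ^+ k.+2).
Proof.
move=> m_ge0 le_v2u2; pose i2 : 'I_k.+3 := Ordinal (isT : (2 < k.+3)%N).
have binE : k.+2%:R * k.+1%:R = 'C(k.+2, 2)%:R * 2 :> R.
  by rewrite -!natrM [('C(_, _) * 2)%N]mulnC -mul_bin_diag bin1.
have term_ge0 (i : 'I_k.+3) : ~~ odd i ->
  0 <= (m ^+ (k.+2 - i) * u ^+ i) *+ 2 *+ 'C(k.+2, i)
       - (m ^+ (k.+2 - i) * v ^+ i) *+ 2 *+ 'C(k.+2, i).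
  move=> even_i; rewrite -!mulrnBl -mulrBr.
  rewrite !mulrn_wge0 // mulr_ge0 ?exprn_ge0 //.
  rewrite subr_ge0 -(even_halfK even_i) -mul2n !exprM.
  by rewrite lerXn2r ?nnegrE ?sqr_ge0.
rewrite !exprD_add_exprB -sumrB (bigD1 i2) //= subn2 /= binE -[leLHS]addr0.
apply: lerD; last by apply: sumr_ge0 => i /andP[/term_ge0].
rewrite -!mulrnBl -mulrBr -[leRHS]mulr_natl.
by rewrite -[X in _ <= _ * X]mulr_natl !mulrA.
Qed.

Section PowerSumGap.
Variable R : realFieldType.
Implicit Types a b c d : R.

Lemma power_sum_gap a b c d k :
  a + b = c + d -> 0 <= a + b -> a * b <= c * d ->
  k.+2%:R * k.+1%:R * ((a + b) / 2) ^+ k * (c * d - a * b)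
    <= (a ^+ k.+2 + b ^+ k.+2) - (c ^+ k.+2 + d ^+ k.+2).
Proof.
move=> eq_sum sum_ge0 le_prod.
pose m := (a + b) / 2; pose u := (a - b) / 2; pose v := (c - d) / 2.
have -> : c * d - a * b = u ^+ 2 - v ^+ 2 by rewrite /u /v; nra.
have -> : a = m + u by rewrite /m /u; lra.
have -> : b = m - u by rewrite /m /u; lra.
have -> : c = m + v by rewrite /m /v; lra.
have -> : d = m - v by rewrite /m /v; lra.
have -> : (m + u + (m - u)) / 2 = m by lra.
apply: exprD_add_exprB_gap; first by rewrite /m; lra.
by rewrite /u /v; nra.
Qed.

Lemma normr_power_sum_gap a b c d k :
  a + b = c + d -> 0 <= a + b ->
  k.+2%:R * k.+1%:R * ((a + b) / 2) ^+ k * `|c * d - a * b|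
    <= `|(a ^+ k.+2 + b ^+ k.+2) - (c ^+ k.+2 + d ^+ k.+2)|.
Proof.
move=> eq_sum sum_ge0.
wlog le_prod : a b c d eq_sum sum_ge0 / a * b <= c * d => [wlog_le|].
  have [|/ltW le_prod] := leP (a * b) (c * d); first exact: wlog_le.
  by rewrite distrC [leRHS]distrC eq_sum wlog_le // -eq_sum.
rewrite ger0_norm ?subr_ge0 //; apply: le_trans (ler_norm _).
exact: power_sum_gap.
Qed.

End PowerSumGap.

Lemma eq_sum_prod_pair (R : idomainType) (a b c d : R) :
  a + b = c + d -> a * b = c * d -> a = c /\ b = d \/ a = d /\ b = c.
Proof.
move=> eq_sum eq_prod.
have /eqP : (a - c) * (a - d) = 0.
  have -> : (a - c) * (a - d) = a ^+ 2 - (c + d) * a + c * d by ring.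
  by rewrite -eq_sum -eq_prod; ring.
rewrite mulf_eq0 !subr_eq0 => /orP[] /eqP eq_a; [left | right]; split=> //.
  by apply: (addrI a); rewrite eq_sum eq_a.
by apply: (addrI a); rewrite eq_sum eq_a addrC.
Qed.

Lemma eq_sum_prod_fset2 (a b c d : nat) :
  (a + b = c + d)%N -> (a * b = c * d)%N -> [fset a; b]%fset = [fset c; d]%fset.
Proof.
move=> eq_sum eq_prod.
have [||[[->] [->]]|[[->] [->]]] // := eq_sum_prod_pair int a b c d.
- by rewrite -!PoszD eq_sum.
- by rewrite -!PoszM eq_prod.
- exact: fsetUC.
Qed.

Lemma normr_prod_gap_ge1 (R : archiNumDomainType) (a b c d : nat) :
  (a + b = c + d)%N -> [fset a; b]%fset <> [fset c; d]%fset ->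
  1 <= `|c%:R * d%:R - a%:R * b%:R : R|.
Proof.
move=> eq_sum neq_set.
rewrite -!natrM norm_intr_ge1 ?rpredB ?natr_int // subr_eq0 eqr_nat.
by apply/eqP => /esym /(eq_sum_prod_fset2 _ _ _ _ eq_sum).
Qed.

Lemma ler_natr_divn (R : realFieldType) n d : (n %/ d)%:R <= n%:R / d%:R :> R.
Proof.
case: d => [|d]; first by rewrite invr0 mulr0.
by rewrite ler_pdivlMr ?ltr0n // -natrM ler_nat leq_divM.
Qed.

Lemma ler_natr_third_divn2 (R : realFieldType) n :
  (2 <= n)%N -> n%:R / 3 <= (n %/ 2)%:R :> R.
Proof. by move=> n_ge2; rewrite ler_pdivrMr ?ltr0n // -natrM ler_nat; lia. Qed.

Lemma normr_nat_power_sum_gap (R : archiRealFieldType) (k a b c d : nat) :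
  (a + b = c + d)%N -> [fset a; b]%fset <> [fset c; d]%fset ->
  k.+2%:R * k.+1%:R * ((a + b) %/ 2)%:R ^+ k
    <= `|(a%:R ^+ k.+2 + b%:R ^+ k.+2) - (c%:R ^+ k.+2 + d%:R ^+ k.+2) : R|.
Proof.
move=> eq_sum neq_set.
have coef_ge0 : 0 <= k.+2%:R * k.+1%:R :> R by rewrite mulr_ge0 ?ler0n.
apply: le_trans (normr_power_sum_gap R _ _ _ _ k _ _); last 2 first.
- by rewrite -!natrD eq_sum.
- by rewrite addr_ge0 ?ler0n.
rewrite -[leLHS]mulr1 ler_pM ?normr_prod_gap_ge1 ?mulr_ge0 ?exprn_ge0 //.
rewrite ler_wpM2l // lerXn2r ?nnegrE ?divr_ge0 ?addr_ge0 ?ler0n //.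
by rewrite -natrD ler_natr_divn.
Qed.

Theorem theorem2p6 (k a b c d S : nat)
    (hk : (2 <= k)%N) (hab : (a + b)%N = S) (hcd : (c + d)%N = S)
    (hS : (2 <= S)%N) (hne : [fset a; b]%fset <> [fset c; d]%fset) :
  `|a%:R ^+ k + b%:R ^+ k - c%:R ^+ k - d%:R ^+ k : rat|
    >= k%:R * (k%:R - 1) * (S %/ 2)%N%:R ^+ (k - 2)
  /\ (k%:R * (k%:R - 1) * (S %/ 2)%N%:R ^+ (k - 2) : rat)
    >= C_ k * S%:R ^+ (k - 2).
Proof.
case: k hk => [|[|k]] // _; rewrite /C_ subn2 /=.
have -> : k.+2%:R - 1 = k.+1%:R :> rat by rewrite -natr1 addrK.
split.
  rewrite -hab -addrA -opprD; apply: normr_nat_power_sum_gap => //.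
  by rewrite hab.
have -> : 2%:Z - k.+2%:Z = - k%:Z by lia.
rewrite -[leLHS]mulrA ler_wpM2l ?mulr_ge0 ?ler0n //.
rewrite -exprz_inv -exprnP -exprMn mulrC.
by rewrite lerXn2r ?nnegrE ?divr_ge0 ?ler0n // ler_natr_third_divn2.
Qed.
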